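(* Let $b\in\mathbb{C}$ and let $V$ be a finite irreducible nontrivial conformal module over the Lie conformal algebra $\mathcal{W}(b)$. Then $V$ is free of rank one over $\mathbb{C}[\partial]$, and one and only one of the following statements holds: (1) If $b\neq 0$, $V$ is isomorphic to $M_{\Delta,\alpha}$ for some $\Delta,\alpha\in\mathbb{C}$ with $\Delta\neq 0$. (2) If $b=0$, $V$ is isomorphic to $M_{\Delta,\alpha,\beta}$ for some $\Delta,\alpha,\beta\in\mathbb{C}$ with $\Delta\neq 0$ or $\beta\neq 0$.
   Context: A Lie conformal algebra is a $\mathbb{C}[\partial]$-module $\mathcal{A}$ with a $\mathbb{C}$-bilinear $\lambda$-bracket $\mathcal{A}\otimes\mathcal{A}\to\mathbb{C}[\lambda]\otimes\mathcal{A}$, $a\otimes b\mapsto[a_\lambda b]$, satisfying $[\partial a_\lambda b]=-\lambda[a_\lambda b]$, $[a_\lambda\partial b]=(\partial+\lambda)[a_\lambda b]$, $[a_\lambda b]=-[b_{-\lambda-\partial}a]$, and $[a_\lambda[b_\mu c]]=[[a_\lambda b]_{\lambda+\mu}c]+[b_\mu[a_\lambda c]]$. A conformal module over $\mathcal{A}$ is a $\mathbb{C}[\partial]$-module $V$ with a $\mathbb{C}$-bilinear map $\mathcal{A}\otimes V\to V[\lambda]$, $a\otimes v\mapsto a_\lambda v$, such that $a_\lambda(b_\mu v)-b_\mu(a_\lambda v)=[a_\lambda b]_{\lambda+\mu}v$, $(\partial a)_\lambda v=-\lambda a_\lambda v$, $a_\lambda(\partial v)=(\partial+\lambda)a_\lambda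 v$. It is finite if finitely generated over $\mathbb{C}[\partial]$; irreducible if it is nonzero and its only submodules are $0$ and itself; trivial if $a_\lambda v=0$ for all $a\in\mathcal{A}$, $v\in V$, and nontrivial otherwise. For $b\in\mathbb{C}$, $\mathcal{W}(b)$ is the Lie conformal algebra that is free over $\mathbb{C}[\partial]$ with basis $L,H$ and brackets $[L_\lambda L]=(\partial+2\lambda)L$, $[L_\lambda H]=(\partial+(1-b)\lambda)H$, $[H_\lambda H]=0$. For $b\neq0$ and $\Delta,\alpha\in\mathbb{C}$, $M_{\Delta,\alpha}=\mathbb{C}[\partial]v$ is the $\mathcal{W}(b)$-module free of rank one over $\mathbb{C}[\partial]$ with $L_\lambda v=(\partial+\alpha+\Delta\lambda)v$, $H_\lambda v=0$. For $b=0$ and $\Delta,\alpha,\beta\in\mathbb{C}$, $M_{\Delta,\alpha,\beta}=\mathbb{C}[\partial]v$ is the $\mathcal{W}(0)$-module free of rank one over $\mathbb{C}[\partial]$ with $L_\lambda v=(\partial+\alpha+\Delta\lambda)v$, $H_\lambda v=\beta v$. *)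

(* Defs.v *)
From HB Require Import structures.
From mathcomp Require Import all_boot all_order all_algebra.
From mathcomp Require Import polyXY.
From mathcomp Require Import ring.

Set Implicit Arguments.
Unset Strict Implicit.
Unset Printing Implicit Defensive.

Import GRing.Theory.
Local Open Scope ring_scope.

(* A K[∂]-module is an lmodType over {poly K}: ∂ acts as 'X *: _ and a scalar *)
(* c : K acts as c%:P *: _. An element of V[λ] is given by its sequence of    *)
(* coefficients p : nat -> V (p n is the coefficient of λ^n), together with a *)
(* proof that almost all of them vanish; an element of V[λ,μ] likewise by a   *)
(* function of the exponents m of λ and n of μ. Identities in V[λ] and        *)
(* V[λ,μ] are stated coefficientwise.                                         *)

(* λ p(λ) *)
Definition mul_lambda (V : nmodType) (p : nat -> V) (n : nat) : V :=
  if n is n'.+1 then p n' else 0.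

(* The coefficient of λ^m in p(-λ-∂), where p has degree < N. The powers of   *)
(* -λ-∂ are computed in {poly {poly K}}, with 'X for λ and 'Y = 'X%:P for ∂.  *)
Definition subst_skew (K : fieldType) (V : lmodType {poly K})
    (p : nat -> V) (N m : nat) : V :=
  \sum_(n < N) ((- 'X - 'Y : {poly {poly K}}) ^+ n)`_m *: p n.

(* The coefficient of λ^m μ^n in \sum_k λ^k q_k(λ+μ), where q k j is the      *)
(* coefficient of ν^j in q_k(ν).                                              *)
Definition subst_add (V : nmodType) (q : nat -> nat -> V) (m n : nat) : V :=
  \sum_(k < m.+1) q k (m - k + n)%N *+ 'C(m - k + n, n).

(* lbr a b is [a_λ b]. *)
HB.mixin Record isLieConformal (K : fieldType) A of GRing.Lmodule {poly K} A := {
  lbr : A -> A -> nat -> A;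
  lbr_fin : forall a b, exists N, forall n, (N <= n)%N -> lbr a b n = 0;
  lbr_linl : forall (c : K) a a' b n,
    lbr (c%:P *: a + a') b n = c%:P *: lbr a b n + lbr a' b n;
  lbr_linr : forall (c : K) a b b' n,
    lbr a (c%:P *: b + b') n = c%:P *: lbr a b n + lbr a b' n;
  lbr_partiall : forall a b n,
    lbr ('X *: a) b n = - mul_lambda (lbr a b) n;
  lbr_partialr : forall a b n,
    lbr a ('X *: b) n = 'X *: lbr a b n + mul_lambda (lbr a b) n;
  lbr_skew : forall a b N, (forall n, (N <= n)%N -> lbr b a n = 0) ->
    forall m, lbr a b m = - subst_skew (lbr b a) N m;
  lbr_jacobi : forall a b c m n,
    lbr a (lbr b c n) m =
    subst_add (fun k => lbr (lbr a b k) c) m n + lbr b (lbr a c m) n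
}.

#[short(type="lieConfType")]
HB.structure Definition LieConformal (K : fieldType) :=
  {A of isLieConformal K A & GRing.Lmodule {poly K} A}.

(* act a v is a_λ v. *)
HB.mixin Record isConformalModule (K : fieldType) (A : lieConfType K) V
    of GRing.Lmodule {poly K} V := {
  act : A -> V -> nat -> V;
  act_fin : forall a v, exists N, forall n, (N <= n)%N -> act a v n = 0;
  act_linl : forall (c : K) a a' v n,
    act (c%:P *: a + a') v n = c%:P *: act a v n + act a' v n;
  act_linr : forall (c : K) a v v' n,
    act a (c%:P *: v + v') n = c%:P *: act a v n + act a v' n;
  act_partiall : forall a v n,
    act ('X *: a) v n = - mul_lambda (act a v) n;
  act_partialr : forall a v n,
    act a ('X *: v) n = 'X *: act a v n + mul_lambda (act a v) n;
  act_jacobi : forall a b v m n,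
    act a (act b v n) m - act b (act a v m) n =
    subst_add (fun k => act (lbr a b k) v) m n
}.

#[short(type="confModType")]
HB.structure Definition ConformalModule (K : fieldType) (A : lieConfType K) :=
  {V of isConformalModule K A V & GRing.Lmodule {poly K} V}.

Section ModuleNotions.
Variables (K : fieldType) (A : lieConfType K).
Implicit Types V W : confModType A.

Definition finite_conf V : Prop :=
  exists (n : nat) (s : 'I_n -> V), forall v : V,
  exists c : 'I_n -> {poly K}, v = \sum_i c i *: s i.

Definition submodule V (U : V -> Prop) : Prop :=
  [/\ U 0, forall u w, U u -> U w -> U (u + w),
      forall (p : {poly K}) u, U u -> U (p *: u) &
      forall (a : A) u n, U u -> U (act a u n)].

Definition irreducible_conf V : Prop :=
  (exists v : V, v <> 0) /\
  forall U : V -> Prop, submodule U ->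
    (forall v, U v <-> v = 0) \/ (forall v, U v).

Definition trivial_conf V : Prop :=
  forall (a : A) (v : V) n, act a v n = 0.

Definition free_rank1 (V : lmodType {poly K}) : Prop :=
  exists v : V, bijective (fun p : {poly K} => p *: v).

Definition isomorphic_conf V W : Prop :=
  exists2 f : {linear V -> W}, bijective f &
  forall (a : A) v n, f (act a v n) = act a (f v) n.

End ModuleNotions.

(* If x_λ y = P(∂,λ) z, then (f(∂)x)_λ (g(∂)y) = f(-λ) g(∂+λ) P(∂,λ) z. Here  *)
(* P : {poly {poly K}}, with 'X for λ and 'Y for ∂.                           *)
Definition sesqui_ext (K : fieldType) (f g : {poly K}) (P : {poly {poly K}}) :
    {poly {poly K}} :=
  (f \Po - 'X)^:P * poly_XaY g * P.

Section Sesqui.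
Variable K : fieldType.
Implicit Types (f g : {poly K}) (P : {poly {poly K}}).

Lemma coef_lambda P n : (P * 'X)`_n = mul_lambda (fun i => P`_i) n.
Proof. by rewrite coefMX; case: n. Qed.

Lemma sesqui_linl c f f' g P :
  sesqui_ext (c%:P * f + f') g P = c%:P%:P * sesqui_ext f g P + sesqui_ext f' g P.
Proof.
rewrite /sesqui_ext comp_polyD comp_polyM comp_polyC.
rewrite rmorphD rmorphM /= map_polyC /=; ring.
Qed.

Lemma sesqui_linr c f g g' P :
  sesqui_ext f (c%:P * g + g') P = c%:P%:P * sesqui_ext f g P + sesqui_ext f g' P.
Proof.
rewrite /sesqui_ext /poly_XaY rmorphD rmorphM /= map_polyC /=.
rewrite comp_polyD comp_polyM comp_polyC; ring.
Qed.

Lemma sesqui_Xl f g P : sesqui_ext ('X * f) g P = - (sesqui_ext f g P * 'X).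
Proof.
rewrite /sesqui_ext comp_polyM comp_polyX rmorphM rmorphN /= map_polyX; ring.
Qed.

Lemma sesqui_Xr f g P :
  sesqui_ext f ('X * g) P = 'Y * sesqui_ext f g P + sesqui_ext f g P * 'X.
Proof.
rewrite /sesqui_ext /poly_XaY rmorphM /= map_polyX comp_polyM comp_polyX; ring.
Qed.

Lemma sesqui0l g P : sesqui_ext 0 g P = 0.
Proof. by rewrite /sesqui_ext comp_poly0 rmorph0 !mul0r. Qed.

Lemma sesqui0r f P : sesqui_ext f 0 P = 0.
Proof. by rewrite /sesqui_ext /poly_XaY rmorph0 comp_poly0 mulr0 mul0r. Qed.

Lemma sesqui1 P : sesqui_ext 1 1 P = P.
Proof.
by rewrite /sesqui_ext /poly_XaY -polyC1 map_polyC !comp_polyC map_polyC !mul1r.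
Qed.

Lemma sesqui_skew f g P :
  sesqui_ext f g P \Po (- 'X - 'Y) = sesqui_ext g f (P \Po (- 'X - 'Y)).
Proof.
have map_comp (h q : {poly K}) : (h \Po q)^:P = h^:P \Po q^:P by rewrite (map_comp_poly polyC).
have opXY : (- 'X : {poly {poly K}}) \Po (- 'X - 'Y) = 'X + 'Y.
  by rewrite rmorphN /= comp_polyX; ring.
have addXY : ('X + 'Y : {poly {poly K}}) \Po (- 'X - 'Y) = - 'X.
  by rewrite comp_polyD comp_polyX comp_polyC; ring.
rewrite /sesqui_ext /poly_XaY !comp_polyM !map_comp rmorphN /= map_polyX.
by rewrite -!comp_polyA opXY addXY; ring.
Qed.

Lemma subst_skew_poly (P : {poly {poly K}}) N m : (size P <= N)%N ->
  \sum_(n < N) ((- 'X - 'Y : {poly {poly K}}) ^+ n)`_m * P`_n =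
  (P \Po (- 'X - 'Y))`_m.
Proof.
move=> sP; rewrite comp_polyE coef_sum (big_ord_widen N (fun i =>
  (P`_i *: (- 'X - 'Y : {poly {poly K}}) ^+ i)`_m)) // [RHS]big_mkcond /=.
apply: eq_bigr => i _; rewrite coefZ mulrC.
by case: ltnP => // si; rewrite nth_default ?mul0r.
Qed.

End Sesqui.

Section SubstAdd.
Variables (R : pzRingType) (V : lmodType R).
Implicit Types p q r : nat -> nat -> V.

Lemma eq_subst_add p q m n : (forall k j, p k j = q k j) ->
  subst_add p m n = subst_add q m n.
Proof. by move=> pq; apply: eq_bigr => k _; rewrite pq. Qed.

Lemma subst_add_lin (c : R) p q m n :
  subst_add (fun k j => c *: p k j + q k j) m n
  = c *: subst_add p m n + subst_add q m n.
Proof.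
rewrite /subst_add scaler_sumr -big_split /=.
by apply: eq_bigr => k _; rewrite mulrnDl scalerMnr.
Qed.

Lemma subst_addD p q m n :
  subst_add (fun k j => p k j + q k j) m n = subst_add p m n + subst_add q m n.
Proof.
by rewrite /subst_add -big_split /=; apply: eq_bigr => k _; rewrite mulrnDl.
Qed.

Lemma subst_addN p m n :
  subst_add (fun k j => - p k j) m n = - subst_add p m n.
Proof. by rewrite /subst_add -sumrN; apply: eq_bigr => k _; rewrite mulNrn. Qed.

Lemma subst_add_mul1 p m n :
  subst_add (fun k j => mul_lambda (p^~ j) k) m n
  = mul_lambda (fun m' => subst_add p m' n) m.
Proof.
rewrite /subst_add big_ord_recl /= mul0rn add0r.
by case: m => [|m]; rewrite ?big_ord0.
Qed.

Lemma subst_add_mul2 p m n :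
  subst_add (fun k => mul_lambda (p k)) m n
  = mul_lambda (fun m' => subst_add p m' n) m + mul_lambda (subst_add p m) n.
Proof.
rewrite /subst_add; case: m => [|m] /=.
  by rewrite big_ord1 add0r; case: n => [|n] //=; rewrite big_ord1 !binn.
rewrite big_ord_recr /= subnn add0n binn mulr1n.
case: n => [|n] /=.
  rewrite !addr0; apply: eq_bigr => k _.
  by rewrite !bin0 subSn -1?ltnS ?addSn.
rewrite [X in _ = _ + X]big_ord_recr /= subnn add0n binn mulr1n addrA.
congr (_ + _); rewrite -big_split /=; apply: eq_bigr => k _.
by rewrite subSn -1?ltnS // !addSn /= binS mulrnDr addnS.
Qed.

Lemma subst_add_deg1 p m n : (forall k j, p k.+2 j = 0) ->
  subst_add p m n = p 0 (m + n)%N *+ 'C(m + n, n)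
    + mul_lambda (fun m' => p 1 (m' + n)%N *+ 'C(m' + n, n)) m.
Proof.
move=> p0; rewrite /subst_add big_ord_recl subn0; congr (_ + _).
case: m => [|m] /=; first by rewrite big_ord0.
rewrite big_ord_recl /= big1 ?addr0; first by rewrite /bump /= subSS subn0.
by move=> k _; rewrite p0 mul0rn.
Qed.

End SubstAdd.

Section Jacobi.
Variables (K : fieldType) (A V : lmodType {poly K}).
Variables (br : A -> A -> nat -> A) (ac : A -> V -> nat -> V).
Hypothesis brl : forall (c : K) a a' b n,
  br (c%:P *: a + a') b n = c%:P *: br a b n + br a' b n.
Hypothesis brr : forall (c : K) a b b' n,
  br a (c%:P *: b + b') n = c%:P *: br a b n + br a b' n.
Hypothesis brXl : forall a b n, br ('X *: a) b n = - mul_lambda (br a b) n.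
Hypothesis brXr : forall a b n,
  br a ('X *: b) n = 'X *: br a b n + mul_lambda (br a b) n.
Hypothesis acl : forall (c : K) a a' v n,
  ac (c%:P *: a + a') v n = c%:P *: ac a v n + ac a' v n.
Hypothesis acr : forall (c : K) a v v' n,
  ac a (c%:P *: v + v') n = c%:P *: ac a v n + ac a v' n.
Hypothesis acXl : forall a v n, ac ('X *: a) v n = - mul_lambda (ac a v) n.
Hypothesis acXr : forall a v n,
  ac a ('X *: v) n = 'X *: ac a v n + mul_lambda (ac a v) n.

Let jac a b v := forall m n,
  ac a (ac b v n) m = subst_add (fun k => ac (br a b k) v) m n
                      + ac b (ac a v m) n.

Lemma jac_ac0l v n : ac 0 v n = 0.
Proof.
by have := acl (-1) 0 0 v n; rewrite polyCN polyC1 !scaleN1r oppr0 addr0 addNr.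
Qed.

Lemma jac_ac0r a n : ac a 0 n = 0.
Proof.
by have := acr (-1) a 0 0 n; rewrite polyCN polyC1 !scaleN1r oppr0 addr0 addNr.
Qed.

Lemma jac_br0l v n : br 0 v n = 0.
Proof.
by have := brl (-1) 0 0 v n; rewrite polyCN polyC1 !scaleN1r oppr0 addr0 addNr.
Qed.

Lemma jac_br0r a n : br a 0 n = 0.
Proof.
by have := brr (-1) a 0 0 n; rewrite polyCN polyC1 !scaleN1r oppr0 addr0 addNr.
Qed.

Lemma jac_acDl a a' v n : ac (a + a') v n = ac a v n + ac a' v n.
Proof. by have := acl 1 a a' v n; rewrite polyC1 !scale1r. Qed.

Lemma jac_acDr a v v' n : ac a (v + v') n = ac a v n + ac a v' n.
Proof. by have := acr 1 a v v' n; rewrite polyC1 !scale1r. Qed.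

Lemma jac_acNl a v n : ac (- a) v n = - ac a v n.
Proof.
by have := acl (-1) a 0 v n; rewrite polyCN polyC1 !scaleN1r !addr0 jac_ac0l addr0.
Qed.

Lemma jac_acNr a v n : ac a (- v) n = - ac a v n.
Proof.
by have := acr (-1) a v 0 n; rewrite polyCN polyC1 !scaleN1r !addr0 jac_ac0r addr0.
Qed.

Lemma jac_lin1 c a a' b v : jac a b v -> jac a' b v -> jac (c%:P *: a + a') b v.
Proof.
move=> ja ja' m n; rewrite acl ja ja' acl acr scalerDr addrACA -subst_add_lin.
by congr (_ + _); apply: eq_subst_add => k j; rewrite brl acl.
Qed.

Lemma jac_lin2 c a b b' v : jac a b v -> jac a b' v -> jac a (c%:P *: b + b') v.
Proof.
move=> ja ja' m n; rewrite acl acr ja ja' acl scalerDr addrACA -subst_add_lin.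
by congr (_ + _); apply: eq_subst_add => k j; rewrite brr acl.
Qed.

Lemma jac_lin3 c a b v v' : jac a b v -> jac a b v' -> jac a b (c%:P *: v + v').
Proof.
move=> ja ja' m n; rewrite !acr ja ja' scalerDr addrACA -subst_add_lin.
by congr (_ + _); apply: eq_subst_add => k j; rewrite acr.
Qed.

Lemma jac_X1 a b v : jac a b v -> jac ('X *: a) b v.
Proof.
move=> ja m n.
under eq_subst_add => k j.
  have -> : ac (br ('X *: a) b k) v j = - mul_lambda (fun i => ac (br a b i) v j) k.
    by rewrite brXl; case: k => [|k] /=; rewrite ?oppr0 ?jac_ac0l ?jac_acNl.
  over.
rewrite subst_addN subst_add_mul1 !acXl jac_acNr -opprD.
by case: m => [|m] /=; rewrite ?jac_ac0r ?addr0 // ja.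
Qed.

Lemma jac_X2 a b v : jac a b v -> jac a ('X *: b) v.
Proof.
move=> ja m n.
under eq_subst_add => k j.
  have -> : ac (br a ('X *: b) k) v j =
      - mul_lambda (ac (br a b k) v) j + mul_lambda (fun i => ac (br a b i) v j) k.
    rewrite brXr jac_acDl acXl; congr (_ + _).
    by case: k => [|k] /=; rewrite ?jac_ac0l.
  over.
rewrite subst_addD subst_addN subst_add_mul2 subst_add_mul1 !acXl jac_acNr.
have cancel (x y : V) : - (x + y) + x = - y by rewrite opprD addrAC addNr add0r.
rewrite cancel -opprD; congr (- _).
by case: n => [|n] /=; rewrite ?jac_ac0r ?addr0 // ja.
Qed.

Lemma jac_X3 a b v : jac a b v -> jac a b ('X *: v).
Proof.
move=> ja m n.
under eq_subst_add do rewrite acXr.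
rewrite subst_add_lin subst_add_mul2 !acXr !jac_acDr !acXr ja scalerDr.
have -> : mul_lambda (ac a (ac b v n)) m =
    mul_lambda (fun m' => subst_add (fun k => ac (br a b k) v) m' n) m
    + ac b (mul_lambda (ac a v) m) n.
  by case: m => [|m] /=; rewrite ?jac_ac0r ?addr0.
have -> : ac a (mul_lambda (ac b v) n) m =
    mul_lambda (subst_add (fun k => ac (br a b k) v) m) n
    + mul_lambda (ac b (ac a v m)) n.
  by case: n => [|n] /=; rewrite ?jac_ac0r ?addr0.
by rewrite [LHS](AC (2*2*2) (1*(3*5)*(2*6*4))).
Qed.

Lemma jac_gen (T : lmodType {poly K}) (P : T -> Prop) :
  (forall (c : K) x y, P x -> P y -> P (c%:P *: x + y)) ->
  (forall x, P x -> P ('X *: x)) ->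
  forall x y (p q : {poly K}), P x -> P y -> P (p *: x + q *: y).
Proof.
move=> Plin PX x y p q Px Py.
have P0 : P 0.
  by have := Plin (-1) _ _ Px Px; rewrite polyCN polyC1 scaleN1r addNr.
have PD u w : P u -> P w -> P (u + w).
  by move=> Pu Pw; have := Plin 1 _ _ Pu Pw; rewrite polyC1 scale1r.
have Psc r z : P z -> P (r *: z).
  move=> Pz; elim/poly_ind: r => [|r c Pr]; first by rewrite scale0r.
  by rewrite scalerDl addrC mulrC -scalerA; apply: Plin => //; apply: PX.
by apply: PD; apply: Psc.
Qed.

Lemma jac_ext (a0 a1 : A) (v0 v1 : V) :
  (forall a, exists p q, a = p *: a0 + q *: a1) ->
  (forall v, exists p q, v = p *: v0 + q *: v1) ->
  (forall i j k : bool,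
    jac (if i then a1 else a0) (if j then a1 else a0) (if k then v1 else v0)) ->
  forall a b v, jac a b v.
Proof.
move=> Agen Vgen gen.
have {}gen i j v : jac (if i then a1 else a0) (if j then a1 else a0) v.
  have [p [q ->]] := Vgen v.
  apply: (@jac_gen _ (fun v => jac _ _ v)); [|exact: jac_X3|..].
  - by move=> *; apply: jac_lin3.
  - exact: (gen i j false).
  - exact: (gen i j true).
have {}gen i b v : jac (if i then a1 else a0) b v.
  have [p [q ->]] := Agen b.
  apply: (@jac_gen _ (fun b => jac _ b _)).
  - by move=> *; apply: jac_lin2.
  - by move=> *; apply: jac_X2.
  - exact: (gen i false).
  - exact: (gen i true).
move=> a b v; have [p [q ->]] := Agen a.
apply: (@jac_gen _ (fun a => jac a _ _)).
- by move=> *; apply: jac_lin1.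
- by move=> *; apply: jac_X1.
- exact: (gen false).
- exact: (gen true).
Qed.

End Jacobi.

(* The Jacobi identity on the generators L and H of W(b), for the adjoint     *)
(* action and for an action on a module generated by one element v.           *)
Section Generators.
Variables (K R : comNzRingType) (cst : {rmorphism K -> R}) (d : R) (b : K).
Variables (A : lmodType R) (L H : A) (br : A -> A -> nat -> A).
Hypothesis brLL : forall n, br L L n = nth 0 [:: d *: L; cst 2%:R *: L] n.
Hypothesis brLH : forall n, br L H n = nth 0 [:: d *: H; cst (1 - b) *: H] n.
Hypothesis brHL : forall n,
  br H L n = nth 0 [:: cst (- b) *: (d *: H); cst (1 - b) *: H] n.
Hypothesis brHH : forall n, br H H n = 0.

Let gen (i : bool) := if i then H else L.

Section Action.
Variables (V : lmodType R) (ac : A -> V -> nat -> V).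
Hypothesis ac0l : forall v n, ac 0 v n = 0.
Hypothesis ac0r : forall x n, ac x 0 n = 0.
Hypothesis acZl : forall c x v n, ac (cst c *: x) v n = cst c *: ac x v n.
Hypothesis acZr : forall c x v n, ac x (cst c *: v) n = cst c *: ac x v n.
Hypothesis acdl : forall x v n, ac (d *: x) v n = - mul_lambda (ac x v) n.
Hypothesis acdr : forall x v n,
  ac x (d *: v) n = d *: ac x v n + mul_lambda (ac x v) n.

Lemma subst_add_gen (i j : bool) v m n :
  subst_add (fun k => ac (br (gen i) (gen j) k) v) m n =
  ac (br (gen i) (gen j) 0) v (m + n)%N *+ 'C(m + n, n)
  + mul_lambda (fun m' => ac (br (gen i) (gen j) 1) v (m' + n)%N
                          *+ 'C(m' + n, n)) m.
Proof.
apply: subst_add_deg1 => k l.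
have -> : br (gen i) (gen j) k.+2 = 0.
  by case: i; case: j; rewrite /gen ?brLL ?brLH ?brHL ?brHH /= ?nth_nil.
exact: ac0l.
Qed.

Lemma jac_rank1 (v : V) (Delta alpha beta : K) :
  (forall x u w n, ac x (u + w) n = ac x u n + ac x w n) ->
  (forall n, ac L v n = nth 0 [:: (d + cst alpha) *: v; cst Delta *: v] n) ->
  (forall n, ac H v n = nth 0 [:: cst beta *: v] n) ->
  b * beta = 0 ->
  forall (i j : bool) m n,
  ac (gen i) (ac (gen j) v n) m =
  subst_add (fun k => ac (br (gen i) (gen j) k) v) m n
  + ac (gen j) (ac (gen i) v m) n.
Proof.
move=> acDr acL acH /(congr1 cst); rewrite rmorphM rmorph0 => bbeta0 i j m n.
pose br_ := (brLL, brLH, brHL, brHH).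
pose ac_ := (acL, acH).
pose sesq := (acdl, acdr, acZl, acZr, ac0l, ac0r, acDr, scalerDl).
pose sc := (scaler0, add0r, addr0, oppr0, mul0rn, scalerDr, scalerA, scalerMnl).
rewrite subst_add_gen /gen.
case: i; case: j; case: m => [|[|[|m]]]; case: n => [|[|[|n]]];
  rewrite ?br_ ?ac_ /= ?nth_nil ?(addnS, addSn, add0n, addn0);
  rewrite ?sesq /= ?ac_ /= ?sesq /= ?ac_ /= ?nth_nil ?sc //.
all: rewrite ?bin0 ?binn ?bin1 ?mulr1n -?scaleNr ?scalerMnl ?scalerA.
all: rewrite -?scalerDl -?scaleNr -?scalerDl.
all: rewrite ?(rmorphN, rmorphB, rmorph1, rmorph_nat).
all: rewrite -1?[0 in LHS](scale0r v); congr (_ *: _).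
all: by rewrite ?mulrDl ?mulNr ?mulrN ?bbeta0; ring.
Qed.

End Action.

Hypothesis br0l : forall x n, br 0 x n = 0.
Hypothesis br0r : forall x n, br x 0 n = 0.
Hypothesis brZl : forall c x y n, br (cst c *: x) y n = cst c *: br x y n.
Hypothesis brZr : forall c x y n, br x (cst c *: y) n = cst c *: br x y n.
Hypothesis brdl : forall x y n, br (d *: x) y n = - mul_lambda (br x y) n.
Hypothesis brdr : forall x y n,
  br x (d *: y) n = d *: br x y n + mul_lambda (br x y) n.

Lemma jac_adjoint (i j k : bool) m n :
  br (gen i) (br (gen j) (gen k) n) m =
  subst_add (fun l => br (br (gen i) (gen j) l) (gen k)) m n
  + br (gen j) (br (gen i) (gen k) m) n.
Proof.
pose br_ := (brLL, brLH, brHL, brHH).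
pose sesq := (brdl, brdr, brZl, brZr, br0l, br0r).
pose sc := (scaler0, add0r, addr0, oppr0, mul0rn, scalerDr, scalerA, scalerMnl).
rewrite subst_add_gen // /gen.
case: i; case: j; case: k; case: m => [|[|[|m]]]; case: n => [|[|[|n]]];
  rewrite ?br_ /= ?nth_nil ?(addnS, addSn, add0n, addn0);
  rewrite ?sesq /= ?br_ /= ?sesq /= ?br_ /= ?nth_nil ?sc //.
all: rewrite ?bin0 ?binn ?bin1 ?mulr1n -?scaleNr ?scalerMnl ?scalerA.
all: rewrite -?scalerDl -?scaleNr -?scalerDl.
all: rewrite ?(rmorphN, rmorphB, rmorph1, rmorph_nat).
all: try by congr (_ *: _); ring.
all: by rewrite [X in X *: _](_ : _ = 0) ?scale0r //; ring.
Qed.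

End Generators.

(* W(b) = K[∂]L + K[∂]H, with f(∂)L + g(∂)H represented by the pair (f, g).   *)
Definition W (K : fieldType) (b : K) : Type := ({poly K}^o * {poly K}^o)%type.

Section W.
Variables (K : fieldType) (b : K).

HB.instance Definition _ := GRing.Lmodule.on (W b).

Definition W_L : W b := (1, 0).
Definition W_H : W b := (0, 1).

Definition W_LL : {poly {poly K}} := 'Y + 2%:R * 'X.
Definition W_LH : {poly {poly K}} := 'Y + (1 - b)%:P%:P * 'X.
(* [H_λ L] = -[L_{-λ-∂} H] by skew-symmetry. *)
Definition W_HL : {poly {poly K}} := - (W_LH \Po (- 'X - 'Y)).

Definition W_lbr (x y : W b) (n : nat) : W b :=
  ((sesqui_ext x.1 y.1 W_LL)`_n,
   (sesqui_ext x.1 y.2 W_LH + sesqui_ext x.2 y.1 W_HL)`_n).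

Lemma W_eq (x y : W b) : x.1 = y.1 -> x.2 = y.2 -> x = y.
Proof. by case: x y => [x1 x2] [y1 y2] /= -> ->. Qed.

Lemma W_HLE : W_HL = (- b)%:P%:P * 'Y + (1 - b)%:P%:P * 'X.
Proof.
rewrite /W_HL /W_LH comp_polyD comp_polyM !comp_polyC comp_polyX.
by rewrite polyCN polyCB polyC1 polyCN polyCB polyC1; ring.
Qed.

Lemma W_LL_skew : W_LL \Po (- 'X - 'Y) = - W_LL.
Proof.
rewrite /W_LL comp_polyD comp_polyM rmorph_nat comp_polyC comp_polyX; ring.
Qed.

Lemma W_HL_skew : W_HL \Po (- 'X - 'Y) = - W_LH.
Proof.
rewrite W_HLE /W_LH comp_polyD !comp_polyM !comp_polyC comp_polyX.
by rewrite polyCN polyCB polyC1 polyCN polyCB polyC1; ring.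
Qed.

Lemma W_lbr_fin x y : exists N, forall n, (N <= n)%N -> W_lbr x y n = 0.
Proof.
exists (maxn (size (sesqui_ext x.1 y.1 W_LL))
             (size (sesqui_ext x.1 y.2 W_LH + sesqui_ext x.2 y.1 W_HL))) => n.
by rewrite geq_max => /andP[n1 n2]; rewrite /W_lbr !nth_default.
Qed.

Lemma W_lbr_linl (c : K) x x' y n :
  W_lbr (c%:P *: x + x') y n = c%:P *: W_lbr x y n + W_lbr x' y n.
Proof.
apply: W_eq => /=.
  by rewrite [x in sesqui_ext x](_ : _ = c%:P * x.1 + x'.1) // sesqui_linl coefD coefCM.
rewrite [x in sesqui_ext x y.2](_ : _ = c%:P * x.1 + x'.1) //.
rewrite [x in sesqui_ext x y.1](_ : _ = c%:P * x.2 + x'.2) //.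
by rewrite !sesqui_linl addrACA -mulrDr coefD coefCM.
Qed.

Lemma W_lbr_linr (c : K) x y y' n :
  W_lbr x (c%:P *: y + y') n = c%:P *: W_lbr x y n + W_lbr x y' n.
Proof.
apply: W_eq => /=.
  by rewrite [y in sesqui_ext _ y](_ : _ = c%:P * y.1 + y'.1) // sesqui_linr coefD coefCM.
rewrite [y in sesqui_ext x.1 y](_ : _ = c%:P * y.2 + y'.2) //.
rewrite [y in sesqui_ext x.2 y](_ : _ = c%:P * y.1 + y'.1) //.
by rewrite !sesqui_linr addrACA -mulrDr coefD coefCM.
Qed.

Lemma W_pair_lambda (P Q : {poly {poly K}}) n :
  ((P * 'X)`_n, (Q * 'X)`_n) = mul_lambda (fun i => (P`_i, Q`_i) : W b) n.
Proof. by rewrite !coef_lambda; case: n. Qed.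

Lemma W_lbr_partiall x y n :
  W_lbr ('X *: x) y n = - mul_lambda (W_lbr x y) n.
Proof.
rewrite -W_pair_lambda; apply: W_eq => /=.
  by rewrite [x in sesqui_ext x](_ : _ = 'X * x.1) // sesqui_Xl coefN.
rewrite [x in sesqui_ext x y.2](_ : _ = 'X * x.1) //.
rewrite [x in sesqui_ext x y.1](_ : _ = 'X * x.2) //.
by rewrite !sesqui_Xl -opprD -mulrDl coefN.
Qed.

Lemma W_lbr_partialr x y n :
  W_lbr x ('X *: y) n = 'X *: W_lbr x y n + mul_lambda (W_lbr x y) n.
Proof.
rewrite -W_pair_lambda; apply: W_eq => /=.
  by rewrite [y in sesqui_ext _ y](_ : _ = 'X * y.1) // sesqui_Xr coefD coefCM.
rewrite [y in sesqui_ext x.1 y](_ : _ = 'X * y.2) //.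
rewrite [y in sesqui_ext x.2 y](_ : _ = 'X * y.1) //.
by rewrite !sesqui_Xr addrACA -mulrDl -mulrDr coefD coefCM.
Qed.

Lemma LL_skew (f g : {poly K}) :
  sesqui_ext f g W_LL = - (sesqui_ext g f W_LL \Po (- 'X - 'Y)).
Proof. by rewrite sesqui_skew W_LL_skew /sesqui_ext; ring. Qed.

Lemma LH_skew (f f' g g' : {poly K}) :
  sesqui_ext f g' W_LH + sesqui_ext f' g W_HL =
  - ((sesqui_ext g f' W_LH + sesqui_ext g' f W_HL) \Po (- 'X - 'Y)).
Proof.
rewrite comp_polyD !sesqui_skew W_HL_skew -[W_LH \Po _]opprK -/W_HL.
by rewrite /sesqui_ext; ring.
Qed.

Lemma W_lbr_skew x y N : (forall n, (N <= n)%N -> W_lbr y x n = 0) ->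
  forall m, W_lbr x y m = - subst_skew (W_lbr y x) N m.
Proof.
move=> yx0 m.
have fstE : (subst_skew (W_lbr y x) N m).1 =
    (sesqui_ext y.1 x.1 W_LL \Po (- 'X - 'Y))`_m.
  rewrite /subst_skew (raddf_sum fst) /= subst_skew_poly //.
  by apply/leq_sizeP => n /yx0 [].
have sndE : (subst_skew (W_lbr y x) N m).2 =
    ((sesqui_ext y.1 x.2 W_LH + sesqui_ext y.2 x.1 W_HL) \Po (- 'X - 'Y))`_m.
  rewrite /subst_skew (raddf_sum snd) /= subst_skew_poly //.
  by apply/leq_sizeP => n /yx0 [].
have E1 : (sesqui_ext x.1 y.1 W_LL)`_m =
    - ((subst_skew (W_lbr y x) N m).1 : {poly K}).
  by rewrite fstE -coefN -LL_skew.
have E2 : (sesqui_ext x.1 y.2 W_LH + sesqui_ext x.2 y.1 W_HL)`_m =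
    - ((subst_skew (W_lbr y x) N m).2 : {poly K}).
  by rewrite sndE -coefN -LH_skew.
by apply: W_eq; [exact: E1|exact: E2].
Qed.

Lemma W_scaleL (p : {poly K}) : p *: W_L = (p, 0).
Proof.
by apply: W_eq => /=; [rewrite [LHS](mulr1 p) | rewrite [LHS](mulr0 p)].
Qed.

Lemma W_scaleH (p : {poly K}) : p *: W_H = (0, p).
Proof.
by apply: W_eq => /=; [rewrite [LHS](mulr0 p) | rewrite [LHS](mulr1 p)].
Qed.

Lemma W_basis (x : W b) : x = x.1 *: W_L + x.2 *: W_H.
Proof. by rewrite W_scaleL W_scaleH; apply: W_eq; rewrite /= ?addr0 ?add0r. Qed.

Lemma coef_deg1 (c0 c1 : {poly K}) n :
  (c0%:P + c1%:P * 'X)`_n = nth 0 [:: c0; c1] n.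
Proof.
rewrite coefD coefC coefCM coefX.
by case: n => [|[|n]]; rewrite /= ?mulr0 ?mulr1 ?add0r ?addr0 ?nth_nil.
Qed.

Lemma W_lbr_LL n : W_lbr W_L W_L n = nth 0 [:: 'X *: W_L; 2%:P *: W_L] n.
Proof.
rewrite /W_lbr /= sesqui1 !sesqui0l sesqui0r addr0 coef0 !W_scaleL.
rewrite /W_LL -polyC_natr -polyC_natr coef_deg1.
by case: n => [|[|n]] //=; rewrite !nth_nil.
Qed.

Lemma W_lbr_LH n : W_lbr W_L W_H n = nth 0 [:: 'X *: W_H; (1 - b)%:P *: W_H] n.
Proof.
rewrite /W_lbr /= sesqui1 !sesqui0l sesqui0r addr0 coef0 !W_scaleH coef_deg1.
by case: n => [|[|n]] //=; rewrite !nth_nil.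
Qed.

Lemma W_lbr_HL n :
  W_lbr W_H W_L n = nth 0 [:: (- b)%:P *: ('X *: W_H); (1 - b)%:P *: W_H] n.
Proof.
rewrite /W_lbr /= sesqui1 !sesqui0l add0r coef0 scalerA !W_scaleH.
rewrite W_HLE -polyCM coef_deg1.
by case: n => [|[|n]] //=; rewrite !nth_nil.
Qed.

Lemma W_lbr_HH n : W_lbr W_H W_H n = 0.
Proof. by rewrite /W_lbr /= !sesqui0l !sesqui0r addr0 !coef0. Qed.

Lemma W_lbr0l y n : W_lbr 0 y n = 0.
Proof. by rewrite /W_lbr /= !sesqui0l addr0 !coef0. Qed.

Lemma W_lbr0r x n : W_lbr x 0 n = 0.
Proof. by rewrite /W_lbr /= !sesqui0r addr0 !coef0. Qed.

Lemma W_lbrZl (c : K) x y n : W_lbr (c%:P *: x) y n = c%:P *: W_lbr x y n.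
Proof. by rewrite -[c%:P *: x]addr0 W_lbr_linl W_lbr0l addr0. Qed.

Lemma W_lbrZr (c : K) x y n : W_lbr x (c%:P *: y) n = c%:P *: W_lbr x y n.
Proof. by rewrite -[c%:P *: y]addr0 W_lbr_linr W_lbr0r addr0. Qed.

Lemma W_lbr_jacobi x y z m n :
  W_lbr x (W_lbr y z n) m =
  subst_add (fun k => W_lbr (W_lbr x y k) z) m n + W_lbr y (W_lbr x z m) n.
Proof.
have gen (u : W b) : exists p q, u = p *: W_L + q *: W_H.
  by exists u.1, u.2; apply: W_basis.
move: m n; apply: (jac_ext W_lbr_linl W_lbr_linr W_lbr_partiall W_lbr_partialr
  W_lbr_linl W_lbr_linr W_lbr_partiall W_lbr_partialr gen gen).
exact: (@jac_adjoint K _ polyC 'X b _ W_L W_H W_lbr W_lbr_LL W_lbr_LH W_lbr_HL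
  W_lbr_HH W_lbr0l W_lbr0r W_lbrZl W_lbrZr W_lbr_partiall W_lbr_partialr).
Qed.

HB.instance Definition _ := isLieConformal.Build K (W b)
  W_lbr_fin W_lbr_linl W_lbr_linr W_lbr_partiall W_lbr_partialr W_lbr_skew
  W_lbr_jacobi.

End W.

(* The action of W(b) on K[∂]v with L_λ v = (∂ + α + Δλ)v and H_λ v = βv.     *)
Definition rank1_poly (K : fieldType) (Delta alpha beta : K)
    (f g p : {poly K}) : {poly {poly K}} :=
  sesqui_ext f p ('Y + alpha%:P%:P + Delta%:P%:P * 'X)
  + sesqui_ext g p beta%:P%:P.

Definition rank1_act (K : fieldType) (b Delta alpha beta : K)
    (x : W b) (p : {poly K}^o) (n : nat) : {poly K}^o :=
  (rank1_poly Delta alpha beta x.1 x.2 p)`_n.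

Section Rank1.
Variables (K : fieldType) (b Delta alpha beta : K).

Local Notation rpoly := (@rank1_poly K Delta alpha beta).
Local Notation ract := (@rank1_act K b Delta alpha beta).

Lemma rank1_act_fin x p : exists N, forall n, (N <= n)%N -> ract x p n = 0.
Proof. by eexists => n; apply: nth_default. Qed.

Lemma rank1_act_linl (c : K) x y p n :
  ract (c%:P *: x + y) p n = c%:P *: ract x p n + ract y p n.
Proof.
have E (f f' g g' q : {poly K}) : (rpoly (c%:P * f + f') (c%:P * g + g') q)`_n =
    c%:P * (rpoly f g q)`_n + (rpoly f' g' q)`_n.
  by rewrite -coefCM -coefD /rank1_poly !sesqui_linl mulrDr addrACA.
exact: E.
Qed.

Lemma rank1_act_linr (c : K) x p q n :
  ract x (c%:P *: p + q) n = c%:P *: ract x p n + ract x q n.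
Proof.
have E (f g r r' : {poly K}) : (rpoly f g (c%:P * r + r'))`_n =
    c%:P * (rpoly f g r)`_n + (rpoly f g r')`_n.
  by rewrite -coefCM -coefD /rank1_poly !sesqui_linr mulrDr addrACA.
exact: E.
Qed.

Lemma rank1_act_partiall x p n :
  ract ('X *: x) p n = - mul_lambda (ract x p) n.
Proof.
have E (f g r : {poly K}) : (rpoly ('X * f) ('X * g) r)`_n =
    - mul_lambda (fun i => (rpoly f g r)`_i) n.
  by rewrite -coef_lambda -coefN /rank1_poly !sesqui_Xl mulrDl opprD.
exact: E.
Qed.

Lemma rank1_act_partialr x p n :
  ract x ('X *: p) n = 'X *: ract x p n + mul_lambda (ract x p) n.
Proof.
have E (f g r : {poly K}) : (rpoly f g ('X * r))`_n =
    'X * (rpoly f g r)`_n + mul_lambda (fun i => (rpoly f g r)`_i) n.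
  by rewrite -coef_lambda -coefCM -coefD /rank1_poly !sesqui_Xr mulrDl mulrDr addrACA.
exact: E.
Qed.

Let v : {poly K}^o := 1.

Lemma rank1_act_L n :
  ract (W_L b) v n = nth 0 [:: ('X + alpha%:P) *: v; Delta%:P *: v] n.
Proof.
rewrite /rank1_act /rank1_poly sesqui1 sesqui0l addr0 -polyCD coef_deg1.
by case: n => [|[|n]] /=; [exact/esym/mulr1..|rewrite !nth_nil].
Qed.

Lemma rank1_act_H n : ract (W_H b) v n = nth 0 [:: beta%:P *: v] n.
Proof.
rewrite /rank1_act /rank1_poly sesqui1 sesqui0l add0r coefC.
by case: n => [|n] /=; [exact/esym/mulr1|rewrite nth_nil].
Qed.

Lemma rank1_act0l p n : ract 0 p n = 0.
Proof. by rewrite /rank1_act /rank1_poly !sesqui0l addr0 coef0. Qed.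

Lemma rank1_act0r x n : ract x 0 n = 0.
Proof. by rewrite /rank1_act /rank1_poly !sesqui0r addr0 coef0. Qed.

Lemma rank1_actZl (c : K) x p n : ract (c%:P *: x) p n = c%:P *: ract x p n.
Proof. by rewrite -[c%:P *: x]addr0 rank1_act_linl rank1_act0l addr0. Qed.

Lemma rank1_actZr (c : K) x p n : ract x (c%:P *: p) n = c%:P *: ract x p n.
Proof. by rewrite -[c%:P *: p]addr0 rank1_act_linr rank1_act0r addr0. Qed.

Lemma rank1_actDr x p q n : ract x (p + q) n = ract x p n + ract x q n.
Proof. by have := rank1_act_linr 1 x p q n; rewrite polyC1 !scale1r. Qed.

Lemma rank1_act_jacobi : b * beta = 0 -> forall x y p m n,
  ract x (ract y p n) m - ract y (ract x p m) n =
  subst_add (fun k => ract (lbr x y k) p) m n.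
Proof.
move=> bbeta0 x y p m n; apply/eqP; rewrite subr_eq; apply/eqP.
have gen (u : W b) : exists p q, u = p *: W_L b + q *: W_H b.
  by exists u.1, u.2; apply: W_basis.
have genv (u : {poly K}^o) : exists p q, u = p *: v + q *: v.
  by exists u, 0; rewrite scale0r addr0; apply/esym/mulr1.
move: m n; apply: (jac_ext (@W_lbr_linl _ b) (@W_lbr_linr _ b)
  (@W_lbr_partiall _ b) (@W_lbr_partialr _ b)
  rank1_act_linl rank1_act_linr rank1_act_partiall rank1_act_partialr gen genv).
move=> i j k; rewrite if_same.
exact: (@jac_rank1 K _ polyC 'X b _ (W_L b) (W_H b) (@W_lbr _ b)
  (@W_lbr_LL _ b) (@W_lbr_LH _ b) (@W_lbr_HL _ b) (@W_lbr_HH _ b) _ ract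
  rank1_act0l rank1_act0r rank1_actZl rank1_actZr rank1_act_partiall
  rank1_act_partialr v _ _ _ rank1_actDr rank1_act_L rank1_act_H bbeta0).
Qed.

End Rank1.

(* M_{Δ,α}: the action with β = 0. *)
Definition M (K : fieldType) (b Delta alpha : K) : Type := {poly K}^o.

Section M.
Variables (K : fieldType) (b Delta alpha : K).

HB.instance Definition _ := GRing.Lmodule.on (M b Delta alpha).
HB.instance Definition _ :=
  isConformalModule.Build K (W b) (M b Delta alpha)
    (@rank1_act_fin K b Delta alpha 0) (@rank1_act_linl K b Delta alpha 0)
    (@rank1_act_linr K b Delta alpha 0) (@rank1_act_partiall K b Delta alpha 0)
    (@rank1_act_partialr K b Delta alpha 0)
    (@rank1_act_jacobi K b Delta alpha 0 (mulr0 b)).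

End M.

(* M_{Δ,α,β}, a module only because b = 0. *)
Definition M0 (K : fieldType) (b : K) (b0 : b = 0) (Delta alpha beta : K) :
  Type := {poly K}^o.

Section M0.
Variables (K : fieldType) (b : K) (b0 : b = 0) (Delta alpha beta : K).

Fact b0_mul : b * beta = 0. Proof. by rewrite b0 mul0r. Qed.

HB.instance Definition _ := GRing.Lmodule.on (M0 b0 Delta alpha beta).
HB.instance Definition _ :=
  isConformalModule.Build K (W b) (M0 b0 Delta alpha beta)
    (@rank1_act_fin K b Delta alpha beta)
    (@rank1_act_linl K b Delta alpha beta)
    (@rank1_act_linr K b Delta alpha beta)
    (@rank1_act_partiall K b Delta alpha beta)
    (@rank1_act_partialr K b Delta alpha beta)
    (@rank1_act_jacobi K b Delta alpha beta b0_mul).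

End M0.

(* Main.v *)
(* Write L_λ v = Σ λ^m l_m v and H_λ v = Σ λ^m h_m v. The operator l_0 - ∂     *)
(* commutes with ∂ and with the action, and the space ann k of the vectors    *)
(* killed by l_m (m >= k) and h_m (m >= k - 1) meets (∂ - c)V only in         *)
(* (∂ - c)(ann (k - 1)). For k minimal with ann k <> 0 it therefore embeds    *)
(* into V/∂V and is finite-dimensional. On a nonzero finite-dimensional space *)
(* in characteristic 0, a commutator [F, G] commuting with F is singular;     *)
(* applied to l_{k-1}, h_{k-2}, h_{k-3} against l_1 and l_2, this excludes    *)
(* k >= 3. Then h_0 and l_1 have a common eigenvector in ann k, l_0 - ∂ is a  *)
(* scalar, and by irreducibility this eigenvector generates V freely. If all  *)
(* its eigenvalues for l_1 and h_0 were 0, then (∂ + α)V would be a proper    *)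
(* submodule.                                                                 *)

Require Import Defs.
From HB Require Import structures.
From mathcomp Require Import all_boot all_order all_algebra.
From mathcomp Require Import reals complex.
From mathcomp Require Import ring boolp.

Set Implicit Arguments.
Unset Strict Implicit.
Unset Printing Implicit Defensive.

Import GRing.Theory Num.Theory.
Local Open Scope ring_scope.

(** A singular vector, one on which L and H act as on the generator of a rank one module, settles
    everything: by irreducibility and torsion-freeness it generates V freely. So the work is to find
    one ([singular_exists]). Every vector lies in some [ann k], and [ann 0] is zero because V is
    irreducible and nontrivial. Dividing by ∂ - c lowers k by one ([ann_descent]); this gives
    torsion-freeness, and it embeds the first nonzero [ann k] into the quotient of V by ∂V, so that
    it is finite-dimensional ([ann_dim_le]). The modes l_1, l_2, ... and all h_m preserve it, and
    there a commutator commuting with one of its factors is singular ([commutator_singular]). For k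
    at least 3 this would produce a nonzero vector killed by both top modes l_{k-1} and h_{k-2},
    hence lying in the previous, zero, annihilator ([ann_minimal_le]); the value b = 2 - k needs a
    separate commutator. For k at most 2, a common eigenvector of h_0 and l_1 is singular, because
    l_0 - ∂ is a scalar by Schur's argument. *)

Section Subspaces.
Variables (K : fieldType) (W : lmodType K).
Implicit Types (U : W -> Prop) (F G : W -> W).

(** * Linear algebra in finite-dimensional subspaces *)

Definition subspace U : Prop :=
  U 0 /\ forall (c : K) u w, U u -> U w -> U (c *: u + w).

(** A bound that needs no basis, and that passes to smaller subspaces by mere restriction. *)
Definition dim_le n U : Prop :=
  forall u : 'I_n.+1 -> W, (forall i, U (u i)) ->
  exists2 c : 'rV[K]_n.+1, c != 0 & \sum_i c 0 i *: u i = 0.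

Definition stable F U : Prop := forall u, U u -> U (F u).

Definition comb d (e : 'I_d -> W) (c : 'rV[K]_d) : W := \sum_i c 0 i *: e i.

Lemma comb_is_linear d (e : 'I_d -> W) : linear (comb e).
Proof.
move=> a x y; rewrite /comb scaler_sumr -big_split /=; apply: eq_bigr => i _.
by rewrite !mxE scalerDl scalerA.
Qed.

HB.instance Definition _ d (e : 'I_d -> W) :=
  GRing.isLinear.Build K _ _ _ (comb e) (comb_is_linear e).

Definition free_family d (e : 'I_d -> W) : Prop :=
  forall c, comb e c = 0 -> c = 0.

Definition basis U d (e : 'I_d -> W) : Prop :=
  [/\ forall c, U (comb e c),
      forall u, U u -> exists c, u = comb e c &
      free_family e].

Lemma subspace_sum U d (e : 'I_d -> W) c :
  subspace U -> (forall i, U (e i)) -> U (comb e c).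
Proof.
move=> [U0 UD] Ue; rewrite /comb; elim/big_ind: _ => //.
  by move=> x y Ux Uy; have := UD 1 _ _ Ux Uy; rewrite scale1r.
by move=> i _; have := UD (c 0 i) _ _ (Ue i) U0; rewrite addr0.
Qed.

(** A free family of maximal size spans U; [dim_le] bounds that size by n. *)
Lemma basis_exists U n : subspace U -> dim_le n U ->
  exists d (e : 'I_d -> W), basis U e.
Proof.
move=> sU dimU.
pose P d := `[< exists2 e : 'I_d -> W, forall i, U (e i) & free_family e >].
have P0 : P 0%N.
  by apply/asboolP; exists (fun _ => 0); [case | move=> c _; apply/rowP; case].
have Pmax d : P d -> (d <= n)%N.
  move=> /asboolP [e Ue fe]; rewrite leqNgt; apply/negP => lt_nd.
  have [c c0 ce] := dimU (fun i => e (widen_ord lt_nd i)) (fun i => Ue _).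
  (* The relation among the first n + 1 vectors, padded with zeros. *)
  pose c' : 'rV[K]_d := \row_j (if insub (j : nat) is Some i then c 0 i else 0).
  have c'e : comb e c' = 0.
    rewrite -[RHS]ce /comb (bigID (fun j : 'I_d => (j < n.+1)%N)) /=.
    rewrite [X in _ + X]big1 ?addr0; last first.
      by move=> j nj; rewrite mxE insubF ?scale0r //; apply/negbTE.
    rewrite (big_ord_narrow lt_nd); apply: eq_bigr => i _.
    rewrite mxE insubT /= => [|li].
      exact: ltn_ord.
    by congr (c 0 _ *: _); apply: val_inj.
  move/eqP: c0; apply; apply/rowP => i.
  have := fe _ c'e => /rowP /(_ (widen_ord lt_nd i)).
  rewrite !mxE insubT /= => [|li <-].
    exact: ltn_ord.
  by congr (c 0 _); apply: val_inj.
have exP : exists d, P d by exists 0%N.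
case: (ex_maxnP exP Pmax) => d /asboolP [e Ue fe] maxd.
exists d, e; split=> // [c | u Uu]; first exact: subspace_sum.
have [//|nu] := pselect (exists c, u = comb e c).
suff : P d.+1 by move/maxd; rewrite ltnn.
apply/asboolP; exists (fun i => if unlift ord0 i is Some j then e j else u).
  by move=> i; case: unliftP.
move=> c; rewrite /comb big_ord_recl unlift_none => ce.
have cE : \sum_(i < d) c 0 (lift ord0 i) *: e i =
    comb e (\row_i c 0 (lift ord0 i)).
  by apply: eq_bigr => i _; rewrite mxE.
have {}ce : c 0 ord0 *: u + comb e (\row_i c 0 (lift ord0 i)) = 0.
  by rewrite -cE -[RHS]ce; congr (_ + _); apply: eq_bigr => i _; rewrite liftK.
have [c0|c0] := eqVneq (c 0 ord0) 0.
  move: ce; rewrite c0 scale0r add0r => /fe /rowP ce; apply/rowP => i.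
  rewrite mxE; case: (unliftP ord0 i) => [j ->|->]; last by [].
  by have := ce j; rewrite !mxE.
case: nu; exists (- (c 0 ord0)^-1 *: (\row_i c 0 (lift ord0 i))).
apply: (scalerI c0); rewrite linearZ /= scalerA mulrN divff // scaleN1r.
by apply/eqP; rewrite -addr_eq0 ce.
Qed.

Lemma matrix_of U d (e : 'I_d -> W) F : basis U e -> linear F -> stable F U ->
  exists A : 'M[K]_d, forall c, F (comb e c) = comb e (c *m A).
Proof.
move=> [Ue gen fe] linF sF.
pose lF : {linear W -> W} := HB.pack F (GRing.isLinear.Build K W W _ F linF).
have [r rE] : exists r : 'I_d -> 'rV[K]_d, forall i, lF (e i) = comb e (r i).
  apply: (@fin_all_exists _ _ (fun i r => lF (e i) = comb e r)) => i.
  apply: (gen (F (e i))); apply: sF.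
  have -> : e i = comb e (delta_mx 0 i).
    rewrite /comb (bigD1 i) //= big1 ?addr0 ?mxE ?eqxx ?scale1r //.
    move=> j /negbTE ji.
    by rewrite mxE ji andbF scale0r.
  exact: Ue.
exists (\matrix_i r i) => c; rewrite mulmx_sum_row -[F _]/(lF _) {1}/comb.
rewrite !linear_sum.
by apply: eq_bigr => i _; rewrite !linearZ rowK rE.
Qed.

Lemma basis_neq0 U d (e : 'I_d -> W) u : basis U e -> U u -> u <> 0 ->
  (0 < d)%N.
Proof.
move=> [_ gen _] /gen [c ->]; case: d e c {gen} => // e c []; exact: big_ord0.
Qed.

End Subspaces.

Lemma eigenvector_exists (K : closedFieldType) (W : lmodType K) n (U : W -> Prop)
    (F : W -> W) u0 :
  subspace U -> dim_le n U -> linear F -> stable F U -> U u0 -> u0 <> 0 ->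
  exists (a : K) u, [/\ U u, u <> 0 & F u = a *: u].
Proof.
move=> sU dU linF sF Uu0 u00.
have [d [e be]] := basis_exists sU dU.
have d0 := basis_neq0 be Uu0 u00.
have [A FA] := matrix_of be linF sF; case: be => Ue _ fe.
have /closed_rootP [a] : size (char_poly A) != 1.
  by rewrite size_char_poly; case: (d) d0.
rewrite -eigenvalue_root_char => /eigenvalueP [c cA c0].
exists a, (comb e c); split; first exact: Ue.
- by move/fe => c0'; rewrite c0' eqxx in c0.
- by rewrite FA cA linearZ.
Qed.

(* If C were invertible on U, then F would commute with C^-1 and [F, G C^-1]  *)
(* would be a nonzero scalar, which its vanishing trace forbids.              *)
Lemma commutator_singular (K : numFieldType) (W : lmodType K) n (U : W -> Prop)
    (F G C : W -> W) u0 :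
  subspace U -> dim_le n U -> linear F -> linear G ->
  stable F U -> stable G U ->
  (forall u, U u -> F (G u) - G (F u) = C u) ->
  (forall u, U u -> F (C u) = C (F u)) ->
  U u0 -> u0 <> 0 ->
  exists u, [/\ U u, u <> 0 & C u = 0].
Proof.
move=> sU dU linF linG sF sG FG FC Uu0 u00.
have [d [e be]] := basis_exists sU dU.
have d0 := basis_neq0 be Uu0 u00.
have [A FA] := matrix_of be linF sF; have [B GB] := matrix_of be linG sG.
case: be => Ue _ fe.
pose D := B *m A - A *m B.
have CD c : C (comb e c) = comb e (c *m D).
  by rewrite -FG // GB !FA GB mulmxBr !mulmxA linearB.
have inj c c' : comb e c = comb e c' -> c = c'.
  move/eqP; rewrite -subr_eq0 -linearB => /eqP/fe/eqP.
  by rewrite subr_eq0 => /eqP.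
have AD : D *m A = A *m D.
  apply/row_matrixP => i; rewrite !rowE; apply: inj.
  by rewrite !mulmxA -FA -!CD -FA FC.
have : D \notin unitmx.
  apply/negP => uD; have : \tr (D *m invmx D) = 0.
    have AV : A *m invmx D = invmx D *m A.
      rewrite -[LHS]mul1mx -(mulVmx uD) !mulmxA -(mulmxA _ D) AD.
      by rewrite -!mulmxA mulmxV // mulmx1.
    by rewrite mulmxBl linearB /= -mulmxA AV mulmxA mxtrace_mulC mulmxA subrr.
  by rewrite mulmxV // mxtrace1 => /eqP; rewrite pnatr_eq0 -leqn0 leqNgt d0.
rewrite -row_free_unit -kermx_eq0 => /rowV0Pn [c /sub_kermxP cD c0].
exists (comb e c); split=> //; last by rewrite CD cD linear0.
by move/fe => c0'; rewrite c0' eqxx in c0.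
Qed.

(* Restriction of scalars to the constants. *)
Definition scalars (K : fieldType) (V : lmodType {poly K}) : Type := V.

Section Scalars.
Variables (K : fieldType) (V : lmodType {poly K}).

HB.instance Definition _ := GRing.Zmodule.on (scalars V).

Let scale (c : K) (v : scalars V) : scalars V := (c%:P *: (v : V)).

Lemma scalars_scaleA a b v : scale a (scale b v) = scale (a * b) v.
Proof. by rewrite /scale scalerA polyCM. Qed.

Lemma scalars_scale1 : left_id 1 scale.
Proof. by move=> v; rewrite /scale polyC1 scale1r. Qed.

Lemma scalars_scaleDr : right_distributive scale +%R.
Proof. by move=> c u v; rewrite /scale scalerDr. Qed.

Lemma scalars_scaleDl v : {morph scale^~ v : a b / a + b}.
Proof. by move=> a b; rewrite /scale polyCD scalerDl. Qed.

HB.instance Definition _ := GRing.Zmodule_isLmodule.Build K (scalars V)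
  scalars_scaleA scalars_scale1 scalars_scaleDr scalars_scaleDl.

Lemma scalarsE (c : K) (v : scalars V) : c *: v = (c%:P *: (v : V) : V).
Proof. by []. Qed.

End Scalars.

(** * Commutation relations of the modes l_m and h_m *)

Section Modes.
Variables (K : numClosedFieldType) (b : K) (V : confModType (W b)).
Implicit Types (v w : V) (x : W b).

Notation l m v := (act (W_L b) v m).
Notation h m v := (act (W_H b) v m).

Lemma act0r x m : act x (0 : V) m = 0.
Proof. exact: (jac_ac0r (@act_linr _ _ V)). Qed.

Lemma act0l v m : act (0 : W b) v m = 0.
Proof. exact: (jac_ac0l (@act_linl _ _ V)). Qed.

Lemma actDr x v w m : act x (v + w) m = act x v m + act x w m.
Proof. exact: (jac_acDr (@act_linr _ _ V)). Qed.

Lemma actNr x v m : act x (- v) m = - act x v m.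
Proof. exact: (jac_acNr (@act_linr _ _ V)). Qed.

Lemma actZr x (c : K) v m : act x (c%:P *: v) m = c%:P *: act x v m.
Proof. by have := act_linr c x v 0 m; rewrite act0r !addr0. Qed.

Lemma actZl x (c : K) v m : act (c%:P *: x) v m = c%:P *: act x v m.
Proof. by have := act_linl c x 0 v m; rewrite act0l !addr0. Qed.

Lemma act_linear x m : linear ((fun v => act x v m) : scalars V -> scalars V).
Proof. by move=> c u v; exact: act_linr. Qed.

Lemma commutator_gen (i j : bool) v m n :
  let g (i : bool) := if i then W_H b else W_L b in
  act (g i) (act (g j) v n) m - act (g j) (act (g i) v m) n =
  act (W_lbr (g i) (g j) 0) v (m + n)%N *+ 'C(m + n, n)
  + mul_lambda (fun m' => act (W_lbr (g i) (g j) 1) v (m' + n)%N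
                          *+ 'C(m' + n, n)) m.
Proof.
move=> g; rewrite act_jacobi.
exact: (@subst_add_gen K _ polyC 'X b _ _ _ _ (@W_lbr_LL _ b) (@W_lbr_LH _ b)
  (@W_lbr_HL _ b) (@W_lbr_HH _ b) V (@act _ _ V) act0l).
Qed.

Lemma commutator_l0 x v n : x = W_L b \/ x = W_H b ->
  l 0 (act x v n) = act x (l 0 v) n - mul_lambda (act x v) n.
Proof.
move=> xg; apply/eqP; rewrite addrC -subr_eq; apply/eqP.
case: xg => ->.
  have /= -> := commutator_gen false false v 0 n.
  by rewrite W_lbr_LL act_partiall /= add0n binn addr0.
have /= -> := commutator_gen false true v 0 n.
by rewrite W_lbr_LH act_partiall /= add0n binn addr0.
Qed.

(** The term 2λL of the bracket gives the first binomial; the term ∂L gives the second, with a minus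
    sign, since ∂L acts as -λL. *)
Lemma commutator_ll v m n :
  l m.+1 (l n v) - l n (l m.+1 v) =
  (('C(m + n, n)) .*2%:R - 'C((m + n).+1, n)%:R)%:P *: l (m + n)%N v.
Proof.
have /= -> := commutator_gen false false v m.+1 n.
rewrite !W_lbr_LL act_partiall /= actZl scalerMnl mulNrn.
rewrite -scaler_nat -scaleNr -scalerDl.
apply: (congr1 (fun p => p *: _)).
by rewrite polyCB !polyC_natr -mul2n natrM mulr_natr addrC addSn.
Qed.

Lemma commutator_lh v m n :
  l m.+1 (h n v) - h n (l m.+1 v) =
  ((1 - b) * 'C(m + n, n)%:R - 'C((m + n).+1, n)%:R)%:P *: h (m + n)%N v.
Proof.
have /= -> := commutator_gen false true v m.+1 n.
rewrite !W_lbr_LH act_partiall /= actZl scalerMnl mulNrn.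
rewrite -scaler_nat -scaleNr -scalerDl.
apply: (congr1 (fun p => p *: _)).
by rewrite (polyCB (_ * _)) polyCM !polyC_natr mulr_natr addrC addSn.
Qed.

Lemma commutator_hh v m n : h m (h n v) = h n (h m v).
Proof.
apply/eqP; rewrite -subr_eq0; apply/eqP.
have /= -> := commutator_gen true true v m n.
by rewrite !W_lbr_HH act0l mul0rn add0r; case: m => //= m; rewrite act0l mul0rn.
Qed.

End Modes.

(** * Annihilator spaces and the operator l_0 - ∂ *)

Section Annihilators.
Variables (K : numClosedFieldType) (b : K) (V : confModType (W b)).
Implicit Types (v w : V) (x : W b).

Notation l m v := (act (W_L b) v m).
Notation h m v := (act (W_H b) v m).

Lemma poly_span_ind (T : lmodType {poly K}) (P : T -> Prop) (t : T) :
  (forall (c : K) y z, P y -> P z -> P (c%:P *: y + z)) ->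
  (forall y, P y -> P ('X *: y)) -> P t -> forall p : {poly K}, P (p *: t).
Proof.
move=> Plin PX Pt p.
by have := jac_gen Plin PX p 0 Pt Pt; rewrite scale0r addr0.
Qed.

Lemma W_ind (P : W b -> Prop) :
  (forall (c : K) y z, P y -> P z -> P (c%:P *: y + z)) ->
  (forall y, P y -> P ('X *: y)) -> P (W_L b) -> P (W_H b) -> forall x, P x.
Proof.
by move=> Plin PX PL PH x; rewrite (W_basis x); exact: jac_gen.
Qed.

Lemma act_XsubC x (c : K) v m :
  act x (('X - c%:P) *: v) m =
  ('X - c%:P) *: act x v m + mul_lambda (act x v) m.
Proof. by rewrite !scalerBl actDr actNr actZr act_partialr addrAC. Qed.

(** With v_m the coefficient of λ^m in x_λ v, the coefficient of λ^(m+1) in x_λ (∂ - c)v is (∂ -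
    c)v_{m+1} + v_m, so vanishing descends from m + 1 to m, starting beyond the degree of x_λ v. *)
Lemma act_XsubC_descent x (c : K) v k :
  (forall m, (k < m)%N -> act x (('X - c%:P) *: v) m = 0) ->
  forall m, (k <= m)%N -> act x v m = 0.
Proof.
move=> Hv; have [N vN] := act_fin x v.
suff H j m : (k <= m)%N -> (N <= m + j)%N -> act x v m = 0.
  by move=> m km; apply: (H N m km); exact: leq_addl.
elim: j m => [|j IH] m km Nmj; first by apply: vN; rewrite -(addn0 m).
have := Hv m.+1 km; rewrite act_XsubC /= IH ?scaler0 ?add0r //.
  exact: leqW.
by rewrite addSnnS.
Qed.

(* With the Virasoro indexing (L_i proportional to l (i + 1), H_i to h i),    *)
(* the vectors killed by all L_i and H_i with i >= k - 1.                     *)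
Definition ann k (v : V) : Prop :=
  (forall m, (k <= m)%N -> l m v = 0) /\ (forall m, (k <= m.+1)%N -> h m v = 0).

Lemma ann_exists v : exists k, ann k v.
Proof.
have [N1 H1] := act_fin (W_L b) v; have [N2 H2] := act_fin (W_H b) v.
exists (N1 + N2).+1; split=> m km.
  by apply: H1; apply: leq_trans km; rewrite -addnS leq_addr.
by apply: H2; apply: leq_trans (km : (N1 + N2 <= m)%N); rewrite leq_addl.
Qed.

Lemma ann_subspace k : subspace (ann k : scalars V -> Prop).
Proof.
split; first by split=> m _; exact: act0r.
move=> c u w [u1 u2] [w1 w2]; split=> m km.
  by rewrite [LHS]act_linr u1 // w1 // scaler0 addr0.
by rewrite [LHS]act_linr u2 // w2 // scaler0 addr0.
Qed.

Lemma ann_descent k (c : K) w : ann k.+1 (('X - c%:P) *: w) -> ann k w.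
Proof.
move=> [w1 w2]; split; first exact: act_XsubC_descent w1.
case: k w1 w2 => [|k] _ w2 m km.
  (* For k = 0, [ann 1] already constrains every h_m. *)
  by apply: (act_XsubC_descent (k := 0)) (leq0n m) => i _; exact: w2.
by apply: (act_XsubC_descent (k := k)) km => i ki; apply: w2.
Qed.

(** Commuting l_{m+1} past a mode of index n yields a multiple of the mode of index m + n, never a
    lower one. The mode l_0 does lower indices, and [defect] replaces it. *)
Lemma ann_stable_l k m v : ann k v -> ann k (l m.+1 v).
Proof.
move=> [v1 v2]; split=> n kn.
  have := commutator_ll v m n; rewrite [l n v]v1 // act0r sub0r.
  rewrite [l (m + n)%N v]v1 ?scaler0; last exact: leq_trans kn (leq_addl _ _).
  by move/eqP; rewrite oppr_eq0 => /eqP.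
have := commutator_lh v m n; rewrite [h n v]v2 // act0r sub0r.
rewrite v2 ?scaler0; last by rewrite -addnS; exact: leq_trans kn (leq_addl _ _).
by move/eqP; rewrite oppr_eq0 => /eqP.
Qed.

Lemma ann_stable_h k m v : ann k.+1 v -> ann k.+1 (h m v).
Proof.
move=> [v1 v2]; split=> n kn; last by rewrite commutator_hh v2 ?act0r.
case: n kn => // n kn.
have := commutator_lh v n m; rewrite [l n.+1 v]v1 // act0r subr0 => ->.
by rewrite v2 ?scaler0 //; exact: leq_trans kn (leq_addr m n.+1).
Qed.

(** Both l_0 and ∂ have commutator -x_{n-1} with x_n, for x = L or H, so their difference commutes
    with the action. *)
Definition defect (v : V) : V := l 0 v - 'X *: v.

Lemma defect_lin (c : K) v w :
  defect (c%:P *: v + w) = c%:P *: defect v + defect w.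
Proof.
by rewrite /defect act_linr scalerBr scalerDr opprD addrACA !scalerA mulrC.
Qed.

Lemma defect_is_linear : linear (defect : scalars V -> scalars V).
Proof. exact: defect_lin. Qed.

Lemma defect0 : defect 0 = 0.
Proof. by rewrite /defect act0r scaler0 subr0. Qed.

Lemma defectN v : defect (- v) = - defect v.
Proof. by rewrite /defect actNr scalerN opprB opprK addrC. Qed.

Lemma defect_X v : defect ('X *: v) = 'X *: defect v.
Proof. by rewrite /defect act_partialr addr0 scalerBr. Qed.

Lemma defect_act x v n : defect (act x v n) = act x (defect v) n.
Proof.
move: x n; apply: W_ind => [c x y IHx IHy n | x IH n | n | n].
- by rewrite !act_linl defect_lin IHx IHy.
- rewrite !act_partiall defectN; congr (- _).
  by case: n => [|n] /=; [exact: defect0 | rewrite IH].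
- rewrite /defect commutator_l0; last by left.
  by rewrite actDr actNr act_partialr opprD addrA addrAC.
- rewrite /defect commutator_l0; last by right.
  by rewrite actDr actNr act_partialr opprD addrA addrAC.
Qed.

Lemma ann_stable_defect k v : ann k v -> ann k (defect v).
Proof.
by move=> [v1 v2]; split=> m km; rewrite -defect_act ?v1 ?v2 ?defect0.
Qed.

Lemma ann0_act v : ann 0 v -> forall x n, act x v n = 0.
Proof.
move=> [v1 v2]; apply: W_ind => [c x y IHx IHy n | x IH n | n | n].
- by rewrite act_linl IHx IHy scaler0 addr0.
- by rewrite act_partiall; case: n => [|n] /=; rewrite ?IH oppr0.
- exact: v1.
- exact: v2.
Qed.

Lemma submodule_closed (U : V -> Prop) :
  U 0 -> (forall u w, U u -> U w -> U (u + w)) ->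
  (forall (c : K) u, U u -> U (c%:P *: u)) -> (forall u, U u -> U ('X *: u)) ->
  (forall x u n, U u -> U (act x u n)) -> submodule U.
Proof.
move=> U0 UD UZ UX Ua; split=> // p u Uu.
apply: poly_span_ind => // c y z Uy Uz.
by apply: (UD) => //; apply: UZ.
Qed.

End Annihilators.

(** * Singular commutators and eigenvectors of modes *)

Section Commutators.
Variables (K : numClosedFieldType) (b : K) (V : confModType (W b)).
Variables (U : scalars V -> Prop) (n : nat) (u0 : V).
Hypotheses (sU : subspace U) (dU : dim_le n U) (Uu0 : U u0) (u00 : u0 <> 0).

Lemma act_commutator_singular (x y z : W b) i j r (c : K) :
  stable (fun u : scalars V => act x u i) U ->
  stable (fun u : scalars V => act y u j) U -> c != 0 ->
  (forall u : V,
    act x (act y u j) i - act y (act x u i) j = c%:P *: act z u r) ->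
  (forall u, U u -> act x (act z u r) i = act z (act x u i) r) ->
  exists u : V, [/\ U u, u <> 0 & act z u r = 0].
Proof.
move=> sx sy c0 xy xz.
have [||u [Uu u00' cz]] := @commutator_singular K (scalars V) n U
  (fun u => act x u i) (fun u => act y u j) (fun u => c%:P *: act z u r) u0
  sU dU (act_linear x i) (act_linear y j) sx sy _ _ Uu0 u00.
- by move=> u _; exact: xy.
- by move=> u Uu; rewrite actZr xz.
- exists u; split => //; move/(congr1 (fun w : V => c^-1%:P *: w)) : cz.
  by rewrite scalerA -polyCM mulVf // scale1r scaler0.
Qed.

Lemma act_eigenvector (x : W b) i : stable (fun u : scalars V => act x u i) U ->
  exists (a : K) (u : V), [/\ U u, u <> 0 & act x u i = a%:P *: u].
Proof.
move=> sx; exact: (@eigenvector_exists K (scalars V) n U _ u0 sU dU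
  (act_linear x i) sx Uu0 u00).
Qed.

End Commutators.

(** * The first nonzero annihilator of an irreducible module *)

Section Irreducible.
Variables (K : numClosedFieldType) (b : K) (V : confModType (W b)).
Hypotheses (Vfin : finite_conf V) (Virr : irreducible_conf V).
Hypothesis Vnt : ~ trivial_conf V.
Implicit Types (v w : V) (x : W b).

Notation l m v := (act (W_L b) v m).
Notation h m v := (act (W_H b) v m).

(** The vectors killed by the whole algebra form a submodule, which is not V. *)
Lemma ann0_eq0 w : ann 0 w -> w = 0.
Proof.
move=> /ann0_act w0; pose U v := forall x n, act x v n = 0.
have sU : submodule U.
  apply: submodule_closed; rewrite /U.
  - by move=> x n; rewrite act0r.
  - by move=> u v u0 v0 x n; rewrite actDr u0 v0 addr0.
  - by move=> c u u0 x n; rewrite actZr u0 scaler0.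
  - by move=> u u0 x [|n]; rewrite act_partialr /= !u0 scaler0 addr0.
  - by move=> x u n u0 y m; rewrite u0 act0r.
have [/(_ w) [] + _|Uall] := Virr.2 U sU; first exact.
by case: Vnt => x v n; exact: Uall.
Qed.

(* A vector killed by ∂ - c is killed by all of W(b). *)
Lemma torsion_free (p : {poly K}) v : p != 0 -> p *: v = 0 -> v = 0.
Proof.
move=> p0; have [r ->] := closed_field_poly_normal p.
have lp : lead_coef p != 0 by rewrite lead_coef_eq0.
rewrite -mul_polyC mulrC -scalerA; elim: r => [|c r IH].
  rewrite big_nil scale1r => /(congr1 (fun w => (lead_coef p)^-1%:P *: w)).
  by rewrite scalerA -polyCM mulVf // scale1r scaler0.
rewrite big_cons -scalerA => H; apply: IH; apply: ann0_eq0.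
by apply: (@ann_descent _ _ _ _ c); rewrite H; split=> m _; rewrite act0r.
Qed.

Lemma ann_dim_le k : (forall v, ann k v -> v = 0) ->
  exists n, dim_le n (ann k.+1 : scalars V -> Prop).
Proof.
move=> ann0; have [n [s sV]] := Vfin; exists n => u Uu.
have [C CE] : exists C : 'I_n.+1 -> 'I_n -> {poly K},
    forall j, u j = \sum_i C j i *: s i.
  exact: (@fin_all_exists _ _ (fun j c => u j = \sum_i c i *: s i))
    (fun j => sV (u j)).
(* Reduction modulo ∂: a row relation of [M] gives a combination of the u j of the form ∂w, and then
   w lies in [ann k], which is zero. *)
pose M : 'M[K]_(n.+1, n) := \matrix_(j, i) (C j i).[0].
have : kermx M != 0.
  apply/negP; rewrite kermx_eq0 => /eqP; apply/eqP; rewrite neq_ltn ltnS.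
  by rewrite rank_leq_col.
move=> /rowV0Pn [c /sub_kermxP cM c0]; exists c => //.
have Uc : ann k.+1 (comb u c : V).
  by apply: subspace_sum => //; exact: ann_subspace.
pose q i := (\sum_j (c 0 j)%:P * C j i) %/ 'X.
have qE i : \sum_j (c 0 j)%:P * C j i = 'X * q i.
  rewrite mulrC divpK // -['X]subr0 -polyC0 dvdp_XsubCl rootE horner_sum.
  have /rowP /(_ i) := cM; rewrite !mxE => H; apply/eqP; rewrite -[RHS]H.
  by apply: eq_bigr => j _; rewrite !mxE hornerM hornerC.
have cE : comb u c = 'X *: (\sum_i q i *: s i) :> V.
  rewrite scaler_sumr.
  under [RHS]eq_bigr => i _ do rewrite scalerA -qE scaler_suml.
  rewrite exchange_big /=; apply: eq_bigr => j _.
  rewrite scalarsE CE scaler_sumr.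
  by apply: eq_bigr => i _; rewrite scalerA.
have := Uc; rewrite cE -['X in X in ann _ X]subr0 -polyC0.
move=> /ann_descent /ann0 z.
by rewrite -[LHS]/(comb u c) cE z scaler0.
Qed.

Lemma ann_minimal : exists k, (exists2 v : V, ann k.+1 v & v <> 0) /\
  (forall v : V, ann k v -> v = 0).
Proof.
pose P k := `[< exists2 v : V, ann k v & v <> 0 >].
have exP : exists k, P k.
  have [v v0] := Virr.1; have [k kv] := ann_exists v.
  by exists k; apply/asboolP; exists v.
case: (ex_minnP exP) => -[|k] /asboolP [v kv v0] mink.
  by case: v0; exact: ann0_eq0.
exists k; split; first by exists v.
move=> w kw; have [//|w0] := pselect (w = 0).
suff : P k by move/mink; rewrite ltnn.
by apply/asboolP; exists w.
Qed.

(** For k = p + 2, the modes l_{p+2} and h_{p+1} have no common kernel in U. This makes h_{p+1}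
    injective on U, while some commutator makes it singular, whatever b is. *)
Lemma ann_minimal_le k v0 : ann k.+1 v0 -> v0 <> 0 ->
  (forall v : V, ann k v -> v = 0) -> (k <= 1)%N.
Proof.
case: k => [|[|p]] // v0k v00 ann0; have [n dU] := ann_dim_le ann0.
pose U := ann p.+3 : scalars V -> Prop.
have sU : subspace U := ann_subspace V _.
have h_inj u : U u -> h p.+1 u = 0 -> u = 0.
  move=> Uu hu; have [//|u0] := pselect (u = 0).
  pose U' (w : scalars V) := U w /\ h p.+1 w = 0.
  have sU' : subspace U'.
    split; first by split; [exact: sU.1 | rewrite act0r].
    move=> c w1 w2 [Uw1 hw1] [Uw2 hw2]; split; first exact: sU.2.
    by rewrite scalarsE act_linr hw1 hw2 scaler0 addr0.
  have dU' : dim_le n U' by move=> w Uw; apply: dU => i; have [] := Uw i.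
  have stab m : (0 < m)%N -> stable (fun w : scalars V => l m w) U'.
    case: m => // m _ w [Uw hw]; split; first exact: ann_stable_l.
    have := commutator_lh (w : V) m p.+1; rewrite hw act0r sub0r => H.
    apply/eqP; rewrite -oppr_eq0; apply/eqP; rewrite [LHS]H.
    (* The commutator is a multiple of h_{p+1} for m = 0, and of a mode vanishing on U for m > 0. *)
    case: m H => [|m] _; first by rewrite add0n hw scaler0.
    by rewrite Uw.2 ?scaler0 // addSnnS !ltnS leq_addl.
  have cl : (p.+1%:R : K) != 0 by rewrite pnatr_eq0.
  (* [l_{p+2}, l_1] = (p + 1) l_{p+2}, so l_{p+2} is singular on U', and its *)
  (* kernel there lies in ann p.+2.                                          *)
  have [w|//|w [[[w1 w2] hw] w0 lw]] :=
    act_commutator_singular sU' dU' (conj Uu hu) u0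
    (z := W_L b) (r := p.+2) (stab p.+2 isT) (stab 1 isT) cl.
    rewrite commutator_ll addn1 !bin1; congr (_%:P *: _).
    by rewrite -addnn natrD -!natr1; ring.
  case: w0; apply: ann0; split=> m; rewrite leq_eqVlt => /predU1P [mp|pm].
  - by rewrite -mp.
  - exact: w1.
  - by case: mp => <-.
  - exact: w2.
have stab m : stable (fun w : scalars V => l m.+1 w) U.
  by move=> w; exact: ann_stable_l.
have stabh m : stable (fun w : scalars V => h m w) U.
  by move=> w; exact: ann_stable_h.
(* [h_{p+1}, l_1] = (b + p + 1) h_{p+1} *)
have bE : b = - p.+1%:R.
  have [/eqP|cb] := eqVneq (b + p.+1%:R) 0; first by rewrite addr_eq0 => /eqP.
  have [w|//|w [Uw w0 hw]] := act_commutator_singular sU dU v0k v00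
    (z := W_H b) (r := p.+1) (stabh p.+1) (stab 0) cb.
    rewrite -[LHS]opprB commutator_lh add0n binn binSn -scaleNr -polyCN.
    by congr (_%:P *: _); rewrite -!natr1; ring.
  by case: w0; exact: h_inj.
(* for this b, [h_p, l_2] is a nonzero multiple of h_{p+1} *)
have cb : - ('C(p.+2, p)%:R : K) != 0.
  by rewrite oppr_eq0 pnatr_eq0 -lt0n bin_gt0 ltnW.
have [w|w|w [Uw w0 hw]] := act_commutator_singular sU dU v0k v00
    (z := W_H b) (r := p.+1) (stabh p) (stab 1) cb.
- rewrite -[LHS]opprB commutator_lh add1n binSn -scaleNr -polyCN.
  congr (_%:P *: _); rewrite bE.
  have H : (p.+2%:R * p.+1%:R : K) = 2%:R * 'C(p.+2, p)%:R.
    have := mul_bin_down p.+2 p; rewrite -!natrM /= binSn !subSn // subnn.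
    by move=> ->.
  by rewrite !opprK nat1r H; ring.
- by rewrite commutator_hh.
by case: w0; exact: h_inj.
Qed.

End Irreducible.

(** * Singular vectors and rank one modules *)

Section SingularVector.
Variables (K : numClosedFieldType) (b : K) (V : confModType (W b)).
Implicit Types (v w : V) (x : W b) (Delta alpha beta : K).

Notation l m v := (act (W_L b) v m).
Notation h m v := (act (W_H b) v m).

(** The relation b β = 0 covers both families at once: it forces β = 0 when b is nonzero. *)
Definition singular Delta alpha beta v : Prop :=
  [/\ forall m, l m v = nth 0 [:: ('X + alpha%:P) *: v; Delta%:P *: v] m,
      forall m, h m v = nth 0 [:: beta%:P *: v] m & b * beta = 0].

Lemma singular_exists :
  finite_conf V -> irreducible_conf V -> ~ trivial_conf V ->
  exists Delta alpha beta (v : V), v <> 0 /\ singular Delta alpha beta v.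
Proof.
move=> Vfin Virr Vnt.
have [k [[v0 v0k v00] ann0]] := ann_minimal Virr Vnt.
have k1 := ann_minimal_le Vfin v0k v00 ann0.
have [n dU] := ann_dim_le Vfin ann0.
pose U := ann k.+1 : scalars V -> Prop.
have sU : subspace U := ann_subspace _ _.
have [alpha talpha] : exists alpha, forall v, defect v = alpha%:P *: v.
  have [alpha [u [_ u0 du]]] := @eigenvector_exists K (scalars V) n U _ v0 sU dU
    (@defect_is_linear K b V) (@ann_stable_defect K b V k.+1) v0k v00.
  exists alpha.
  (* Schur's argument: this eigenspace is a nonzero submodule, hence V. *)
  have sub : submodule (fun v => defect v = alpha%:P *: v).
    apply: submodule_closed.
    - by rewrite defect0 scaler0.
    - move=> v w dv dw; have := defect_lin 1 v w.
      by rewrite polyC1 !scale1r scalerDr dv dw.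
    - move=> c v dv; have := defect_lin c v 0; rewrite defect0 !addr0 dv => ->.
      by rewrite !scalerA mulrC.
    - by move=> v dv; rewrite defect_X dv !scalerA mulrC.
    - by move=> x v m dv; rewrite defect_act dv actZr.
  by have [/(_ u) [] /(_ du) |] := Virr.2 _ sub.
have stabl : stable (fun w : scalars V => l 1 w) U.
  by move=> w; exact: ann_stable_l.
have stabh : stable (fun w : scalars V => h 0 w) U.
  by move=> w; exact: ann_stable_h.
have lh (w : V) : l 1 (h 0 w) - h 0 (l 1 w) = (- b)%:P *: h 0 w.
  by rewrite commutator_lh !bin0; congr (_%:P *: _); ring.
have [beta [u [Uu u0 hu] bb]] : exists2 beta, exists u : V,
    [/\ U u, u <> 0 & h 0 u = beta%:P *: u] & b * beta = 0.
  (* For b = 0 any eigenvalue of h_0 will do; otherwise [h_0, l_1] = b h_0 makes h_0 singular, and β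
     = 0. *)
  have [b0|b0] := eqVneq b 0.
    have [beta [u Hu]] := act_eigenvector sU dU v0k v00 stabh.
    by exists beta; [exists u | rewrite [X in X * _]b0 mul0r].
  have [w|//|w [Uw w0 hw]] := act_commutator_singular sU dU v0k v00
    (z := W_H b) (r := 0) stabh stabl b0.
    by rewrite -[LHS]opprB lh -scaleNr -polyCN opprK.
  by exists 0; [exists w; rewrite hw scale0r | rewrite mulr0].
pose U' (w : scalars V) := U w /\ h 0 w = beta%:P *: (w : V).
have sU' : subspace U'.
  split; first by split; [exact: sU.1 | rewrite act0r scaler0].
  move=> c w1 w2 [Uw1 hw1] [Uw2 hw2]; split; first exact: sU.2.
  by rewrite scalarsE act_linr hw1 hw2 scalerDr !scalerA mulrC.
have dU' : dim_le n U' by move=> w Uw; apply: dU => i; have [] := Uw i.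
(* On [U'] the commutator [l_1, h_0] is -b β = 0. *)
have stab' : stable (fun w : scalars V => l 1 w) U'.
  move=> w [Uw hw]; split; first exact: stabl.
  have := lh w; rewrite hw actZr scalerA -polyCM mulNr bb oppr0 scale0r.
  by move/eqP; rewrite subr_eq0 => /eqP.
have [Delta [v [[[v1 v2] hv] v_0 lv]]] :=
  act_eigenvector sU' dU' (conj Uu hu) u0 stab'.
(* Since k is at most 1, v is killed by l_m for m > 1 and by h_m for m > 0. *)
exists Delta, alpha, beta, v; split=> //; split=> // -[|m] //=.
- by have := talpha v; rewrite /defect scalerDl => <-; rewrite addrC subrK.
- by case: m => [|m] //=; rewrite nth_nil v1 // ltnS (leq_trans k1).
- by rewrite nth_nil v2 // ltnS (leq_trans k1).
Qed.

Section Rank1.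
Variables (Delta alpha beta : K) (v : V).
Hypothesis sv : singular Delta alpha beta v.

Local Notation ract := (@rank1_act K b Delta alpha beta).

(** Sesquilinearity determines the action on multiples of v from that of L and H on v. *)
Lemma rank1_act_scale x p n : ract x p n *: v = act x (p *: v) n.
Proof.
have [lv hv _] := sv; move: x p n.
have regZ (p : {poly K}) (q : {poly K}^o) :
    (p *: q : {poly K}) *: v = p *: ((q : {poly K}) *: v).
  by rewrite scalerA.
have gen y : (forall n, ract y 1 n *: v = act y v n) ->
    forall p n, ract y p n *: v = act y (p *: v) n.
  move=> y1 q; rewrite -[q]mulr1.
  pose P (q : {poly K}^o) :=
    forall n, ract y q n *: v = act y ((q : {poly K}) *: v) n.
  apply: (@poly_span_ind K {poly K}^o P) => [c r s IHr IHs i|r IH i|i].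
  - rewrite rank1_act_linr [LHS]scalerDl regZ.
    transitivity (c%:P *: act y ((r : {poly K}) *: v) i
                  + act y ((s : {poly K}) *: v) i).
      by apply: congr2; [apply: congr1; exact: IHr | exact: IHs].
    by rewrite -act_linr -regZ -scalerDl.
  - rewrite rank1_act_partialr [LHS]scalerDl regZ.
    rewrite -[RHS]/(act y (('X *: r : {poly K}) *: v) i).
    rewrite [in RHS]regZ act_partialr.
    apply: congr2; first by apply: congr1; exact: IH.
    by case: i => [|i]; [exact: scale0r | exact: IH].
  - by rewrite y1 scale1r.
apply: W_ind => [c x y IHx IHy p n | x IH p n | |].
- by rewrite rank1_act_linl act_linl -IHx -IHy scalerDl scalerA.
- rewrite rank1_act_partiall act_partiall scaleNr; congr (- _).
  by case: n => [|n] /=; rewrite ?scale0r // IH.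
- apply: gen => n; rewrite rank1_act_L lv.
  case: n => [|[|n]] //=; rewrite ?nth_nil ?scale0r //.
    by rewrite [in LHS]/GRing.scale /= mulr1.
  by rewrite [in LHS]/GRing.scale /= mulr1.
- apply: gen => n; rewrite rank1_act_H hv.
  case: n => [|n] //=; rewrite ?nth_nil ?scale0r //.
  by rewrite [in LHS]/GRing.scale /= mulr1.
Qed.

Hypotheses (Virr : irreducible_conf V) (Vnt : ~ trivial_conf V) (v0 : v <> 0).

Lemma scale_singular_inj : injective (fun p : {poly K} => p *: v).
Proof.
move=> p q /eqP; rewrite -subr_eq0 -scalerBl => /eqP pq.
apply/eqP; rewrite -subr_eq0; apply/negPn/negP => pq0.
exact: v0 (torsion_free Virr Vnt pq0 pq).
Qed.

(** Used with d = 1, to see that v generates V, and with d = ∂ + α, to exclude Δ = β = 0. *)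
Lemma multiples_submodule (d : {poly K}) :
  (forall x p n, exists q, ract x (p * d) n = q * d) ->
  submodule (fun w => exists p, w = (p * d) *: v).
Proof.
move=> dstab; split.
- by exists 0; rewrite mul0r scale0r.
- by move=> _ _ [p ->] [q ->]; exists (p + q); rewrite mulrDl scalerDl.
- by move=> p _ [q ->]; exists (p * q); rewrite scalerA mulrA.
- move=> x _ n [p ->]; rewrite -rank1_act_scale.
  by have [q ->] := dstab x p n; exists q.
Qed.

Lemma scale_singular_surj w : exists p : {poly K}, w = p *: v.
Proof.
have [|v_0|Vall] := Virr.2 _ (@multiples_submodule 1 _).
- by move=> x p n; exists (ract x p n : {poly K}); rewrite !mulr1.
- by case: v0; apply/v_0; exists 1; rewrite mul1r scale1r.
- by have [p ->] := Vall w; exists p; rewrite mulr1.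
Qed.

Lemma scale_singular_bij : bijective (fun p : {poly K} => p *: v).
Proof.
have [g gK] := choice scale_singular_surj.
by exists g => [p|w]; [apply: scale_singular_inj; rewrite /= -gK | rewrite -gK].
Qed.

Lemma rank1_iso : exists g : V -> {poly K}^o,
  [/\ linear g, bijective g & forall x w n, g (act x w n) = ract x (g w) n].
Proof.
have [g gK Kg] := scale_singular_bij.
exists g; split; last 1 first.
- by move=> x w n; apply: scale_singular_inj; rewrite Kg rank1_act_scale Kg.
- move=> p u w; apply: scale_singular_inj.
  by rewrite Kg scalerDl -scalerA !Kg.
- by exists (fun p => p *: v).
Qed.

Lemma singular_neq0 : Delta <> 0 \/ beta <> 0.
Proof.
have [D0|/eqP] := eqVneq Delta 0; last by left.
have [B0|/eqP] := eqVneq beta 0; last by right.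
pose d : {poly K} := 'X + alpha%:P.
have d0 : d *: v <> 0.
  rewrite -[X in _ <> X](scale0r v) => /scale_singular_inj /eqP.
  by rewrite -size_poly_eq0 size_XaddC.
have [|v_0|Vall] := Virr.2 _ (@multiples_submodule d _).
(* With Δ = β = 0 the action polynomial has the factor ∂ + α, which is free of λ. *)
- move=> x p n; exists (((x.1 \Po - 'X)^:P * poly_XaY (p * d))`_n).
  rewrite /rank1_act /rank1_poly D0 B0 /sesqui_ext !polyC0 mulr0 mul0r.
  by rewrite !addr0 -polyCD coefMC.
- by case: d0; apply/v_0; exists 1; rewrite mul1r.
(* Freeness would give 1 = p (∂ + α), which fails at ∂ = -α. *)
- have [p] := Vall v; rewrite -[X in X = _]scale1r => /scale_singular_inj /esym.
  move/(congr1 (fun q : {poly K} => q.[- alpha])).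
  rewrite !hornerE addNr mulr0 => /eqP.
  by rewrite eq_sym oner_eq0.
Qed.

End Rank1.
End SingularVector.

Theorem theorem2p8 (R : realType) (b : R[i]) (V : confModType (W b)) :
  finite_conf V -> irreducible_conf V -> ~ trivial_conf V ->
  free_rank1 V /\
  let case1 := b <> 0 /\ exists Delta alpha : R[i],
    Delta <> 0 /\ isomorphic_conf V (M b Delta alpha) in
  let case2 := exists (b0 : b = 0) (Delta alpha beta : R[i]),
    (Delta <> 0 \/ beta <> 0) /\
    isomorphic_conf V (M0 b0 Delta alpha beta) in
  (case1 \/ case2) /\ ~ (case1 /\ case2).
Proof.
move=> Vfin Virr Vnt.
have [Delta [alpha [beta [v [v0 sv]]]]] := singular_exists Vfin Virr Vnt.
split; first by exists v; exact: scale_singular_bij sv Virr Vnt v0.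
move=> case1 case2; split; last by case=> -[b0 _] [].
have D0 := singular_neq0 sv Virr Vnt v0.
have [g [glin gbij gact]] := rank1_iso sv Virr Vnt v0.
have [b0|b0] := eqVneq b 0; [right | left; split; first exact/eqP].
  exists b0, Delta, alpha, beta; split=> //.
  pose f : {linear V -> M0 b0 Delta alpha beta} :=
    HB.pack g (GRing.isLinear.Build _ _ _ _ g glin).
  by exists f.
have beta0 : beta = 0.
  by have [_ _ /eqP] := sv; rewrite mulf_eq0 (negbTE b0) => /eqP.
exists Delta, alpha; split; first by case: D0.
rewrite beta0 in gact.
pose f : {linear V -> M b Delta alpha} :=
  HB.pack g (GRing.isLinear.Build _ _ _ _ g glin).
by exists f.
Qed.
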